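(* Let $M$ be a $q$-starshaped subset of a normed space $X$ and let $S,T:M\to M$ with $q\in\mathrm{Fix}(S)$. Let $\phi:[0,\infty)\to[0,\infty)$ be Lebesgue measurable, Lebesgue summable on each compact subset of $[0,\infty)$, with $\int_0^\epsilon\phi(t)\,dt>0$ for all $\epsilon>0$. Let $\gamma:(0,\infty)\to(0,\infty)$ be continuous and nondecreasing with $\gamma(t)<t$ for all $t>0$, with the convention $\gamma(0)=0$. Suppose that: (i) the ordered pair $(S,T)$ is a generalized $\mathcal{JH}$-suboperator pair with order $n_0$ for some $n_0\in\mathbb{N}$; (ii) for all $x,y\in M$ and each $k\in(0,1)$, $$\psi\Big(\int_0^{\|Tx-Ty\|}\phi(t)\,dt\Big)\le F\Big(\psi\Big(\int_0^{\frac1k\gamma(\|Sx-Sy\|)}\phi(t)\,dt\Big),\ \varphi\Big(\int_0^{\frac1k\gamma(\|Sx-Sy\|)}\phi(t)\,dt\Big)\Big),$$ where $\psi\in\Psi$, $\varphi\in\Phi_u$, $F\in\mathcal{C}$ are such that $(\psi,\varphi,F)$ is strictly monotone; (iii) $wcl(T(M))$ is weakly compact, $S$ is weakly continuous and $X$ satisfies Opial's condition. Then $\mathrm{Fix}(S)\cap\mathrm{Fix}(T)\ne\emptyset$.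
   Context: $\mathrm{Fix}(T)$ is the set of fixed points of $T$; $wcl(A)$ is the weak closure of $A$; $\delta(A)$ is the diameter of $A$. $M$ is $q$-starshaped, with $q\in M$, if for all $x\in M$ the segment $[q,x]=\{(1-k)q+kx:0\le k\le1\}$ is contained in $M$. For self-maps $S,R$ of $M$, $PC(S,R)=\{w:\ w=Sx=Rx\text{ for some }x\in M\}$. $(S,R)$ is a generalized $\mathcal{JH}$-operator pair with order $n\in\mathbb{N}$ ($n\ge1$) if there exist $x\in M$ and $w=Sx=Rx\in PC(S,R)$ with $\|w-x\|\le(\delta(PC(S,R)))^n$. For $M$ $q$-starshaped, $(S,T)$ is a generalized $\mathcal{JH}$-suboperator pair with order $n$ if for each $k\in[0,1]$ the pair $(S,T_k)$ is a generalized $\mathcal{JH}$-operator pair with order $n$, where $T_kx=(1-k)q+kTx$ for $x\in M$. $X$ satisfies Opial's condition if for every sequence $\{x_n\}$ in $X$ weakly convergent to $x\in X$, $\liminf_{n\to\infty}\|x_n-x\|<\liminf_{n\to\infty}\|x_n-y\|$ for all $y\ne x$. $\Psi$ is the set of altering distance functions: continuous non-decreasing $\psi:[0,\infty)\to[0,\infty)$ with $\psi(t)=0$ iff $t=0$. $\Phi_u$ is the set of ultra altering distance functions: continuous nondecreasing $\varphi:[0,\infty)\to[0,\infty)$ with $\varphi(t)>0$ for $t>0$ (and $\varphi(0)\ge0$). $\mathcal{C}$ is the set of $C$-class functions: continuous $F:[0,\infty)^2\to\mathbb{R}$ such that for all $s,t\ge0$: $F(s,t)\le s$, and $F(s,t)=s$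 implies $s=0$ or $t=0$. The triple $(\psi,\varphi,F)$ is strictly monotone if for all $x,y\in[0,\infty)$, $x<y$ implies $F(\psi(x),\varphi(x))<F(\psi(y),\varphi(y))$. *)

(* Defs.v *)
From HB Require Import structures.
From mathcomp Require Export all_boot all_order all_algebra.
From mathcomp Require Export all_classical all_reals all_analysis.
Export Order.TTheory GRing.Theory Num.Theory.
Export numFieldNormedType.Exports.

Set Implicit Arguments.
Unset Strict Implicit.
Unset Printing Implicit Defensive.

Local Open Scope classical_set_scope.
Local Open Scope ring_scope.

(* The carrier of X with the initial topology of all norm-continuous linear
   functionals on X; X itself keeps its norm topology. *)
Definition weak_space (R : realType) (X : normedModType R) : Type :=
  @sup_topology X {f : {linear X -> R^o} | continuous f}
    (fun f => Topological.class (initial_topology (projT1 f : X -> R))).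

HB.instance Definition _ (R : realType) (X : normedModType R) :=
  Topological.on (weak_space X).

Section Weak.
Context {R : realType} {X : normedModType R}.
Local Notation W := (weak_space X).

Definition wcl (A : set X) : set X := @closure W A.

Definition weakly_compact (A : set X) : Prop := @compact W A.

Definition weakly_continuous_on (M : set X) (f : X -> X) : Prop :=
  {within (M : set W), continuous (f : W -> W)}.

Definition weakly_converges (u : nat -> X) (x : X) : Prop :=
  (u : nat -> W) @ \oo --> (x : W).

End Weak.

Definition Opial (R : realType) (X : normedModType R) : Prop :=
  forall (u : nat -> X) (x : X), weakly_converges u x ->
  forall y : X, y <> x ->
  (limn_einf (fun n => `|u n - x|%:E) < limn_einf (fun n => `|u n - y|%:E))%E.

(* Self-maps of a subset M are total functions on X that are required to send
   M to M; everything below depends only on their values on M. *)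
Section JHPairs.
Context {R : realType} {X : normedModType R}.
Implicit Types (M A : set X) (q : X) (S T : X -> X) (n : nat).

Definition segment (q x : X) : set X :=
  [set (1 - k) *: q + k *: x | k in `[0, 1]].

Definition starshaped M q : Prop :=
  M q /\ forall x, M x -> segment q x `<=` M.

Definition Fix M S : set X := [set x | M x /\ S x = x].

Definition PC M S T : set X := [set w | exists2 x, M x & w = S x /\ w = T x].

(* +oo when A is unbounded; only used for nonempty A. *)
Definition diameter A : \bar R :=
  ereal_sup [set d | exists x y, [/\ A x, A y & d = `|x - y|%:E]].

Definition JH_operator_pair M S T n : Prop :=
  (1 <= n)%N /\
  exists x w, [/\ M x, w = S x, w = T x &
    (`|w - x|%:E <= diameter (PC M S T) ^+ n)%E].

Definition JH_suboperator_pair M q S T n : Prop :=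
  forall k : R, 0 <= k <= 1 ->
  JH_operator_pair M S (fun x => (1 - k) *: q + k *: T x) n.

End JHPairs.

(* Functions on [0, +oo[ are total functions on R of which only the values
   on [0, +oo[ are constrained and used. *)
Section Classes.
Context {R : realType}.
Implicit Types (f psi phi : R -> R) (F : R -> R -> R).

Definition altering_distance psi : Prop :=
  [/\ forall t, 0 <= t -> 0 <= psi t,
      {within `[0, +oo[, continuous psi},
      {in `[0, +oo[%R &, {homo psi : s t / s <= t}} &
      forall t, 0 <= t -> (psi t = 0 <-> t = 0)].

Definition ultra_altering_distance phi : Prop :=
  [/\ forall t, 0 <= t -> 0 <= phi t,
      {within `[0, +oo[, continuous phi},
      {in `[0, +oo[%R &, {homo phi : s t / s <= t}} &
      forall t, 0 < t -> 0 < phi t].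

Definition C_class F : Prop :=
  [/\ {within `[0, +oo[ `*` `[0, +oo[, continuous (fun p => F p.1 p.2)},
      forall s t, 0 <= s -> 0 <= t -> F s t <= s &
      forall s t, 0 <= s -> 0 <= t -> F s t = s -> s = 0 \/ t = 0].

Definition strictly_monotone_triple psi phi F : Prop :=
  forall x y, 0 <= x -> 0 <= y -> x < y ->
  F (psi x) (phi x) < F (psi y) (phi y).

(* On R the library's measurable_fun and lebesgue_measure use Borel sets;
   Lebesgue measurability is measurability for the sigma-algebra that
   completed_lebesgue_measure lives on. *)
Definition lebesgueType : measurableType _ :=
  caratheodory_type ((wlength (@idfun R))^*)%mu.

Definition lebesgue_measurable_fun (D : set R) f : Prop :=
  @measurable_fun _ _ lebesgueType (measurableTypeR R) D f.

Definition lebesgue_summable (D : set R) f : Prop :=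
  completed_lebesgue_measure.-integrable D (EFin \o f).

Definition integral0 f (t : R) : R :=
  (\int[completed_lebesgue_measure]_(x in `[0%R, t]) f x)%R.

Definition integrand_class f : Prop :=
  [/\ forall t, 0 <= t -> 0 <= f t,
      lebesgue_measurable_fun `[0, +oo[ f,
      forall K : set R, compact K -> K `<=` `[0, +oo[ ->
        lebesgue_summable K f &
      forall e, 0 < e -> 0 < integral0 f e].

Definition comparison_function (gamma : R -> R) : Prop :=
  [/\ forall t, 0 < t -> 0 < gamma t < t,
      {within `]0, +oo[, continuous gamma},
      {in `]0, +oo[%R &, {homo gamma : s t / s <= t}} &
      gamma 0 = 0].

End Classes.

(* Main.v *)
Require Import Defs.

Local Open Scope classical_set_scope.
Local Open Scope ring_scope.

(* Taking k = 1 in the suboperator hypothesis makes (S, T) itself a generalized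
   JH-operator pair.  Two distinct points of coincidence at distance d would
   contradict (ii) with k = gamma d / d, since then both integrals run over
   [0, d] and the C-class function would attain F s t = s with s, t > 0.  So
   PC(S, T) is a singleton, its diameter vanishes, and the JH inequality turns
   the coincidence point into a common fixed point. *)

(** Equality in [F s t <= s] would force [s = 0] or [t = 0]. *)
Lemma C_class_lt (R : realType) (F : R -> R -> R) (s t : R) :
  C_class F -> 0 < s -> 0 < t -> F s t < s.
Proof.
move=> [_ Fle Feq] s0 t0; rewrite lt_neqAle Fle ?ltW// andbT.
by apply/eqP => /(Feq _ _ (ltW s0) (ltW t0))[] /eqP; rewrite gt_eqF.
Qed.

Lemma altering_distance_gt0 (R : realType) (psi : R -> R) (t : R) :
  altering_distance psi -> 0 < t -> 0 < psi t.
Proof.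
move=> [psi0 _ _ psiE] t0; rewrite lt_neqAle psi0 ?ltW// andbT eq_sym.
by apply/eqP => /(psiE _ (ltW t0))/eqP; rewrite gt_eqF.
Qed.

Lemma diameter_le0 (R : realType) (X : normedModType R) (A : set X) :
  is_subset1 A -> (diameter A <= 0)%E.
Proof.
move=> A1; apply: ge_ereal_sup => _ [x [y [Ax Ay ->]]].
by rewrite (A1 x y Ax Ay) subrr normr0.
Qed.

(** Nonemptiness matters: the supremum over the empty set is [-oo]. *)
Lemma diameter_ge0 (R : realType) (X : normedModType R) (A : set X) :
  A !=set0 -> (0 <= diameter A)%E.
Proof.
move=> [x Ax]; apply: ereal_sup_ubound.
by exists x, x; rewrite subrr normr0.
Qed.

Lemma JH_operator_pair_common_fixed_point (R : realType) (X : normedModType R)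
    (M : set X) (S T : X -> X) (n : nat) :
  is_subset1 (PC M S T) -> JH_operator_pair M S T n ->
  Fix M S `&` Fix M T !=set0.
Proof.
move=> PC1 [n1 [x [w [Mx wS wT]]]].
have PCw : PC M S T w by exists x.
have -> : diameter (PC M S T) = 0%E.
  by apply/eqP; rewrite eq_le diameter_le0// diameter_ge0//; exists w.
(* The order is at least 1, so the power of the zero diameter is 0; with order 0 it would be 1. *)
rewrite -(prednK n1) expeS mul0e lee_fin normr_le0 subr_eq0 => /eqP wx.
by exists x; split; split=> //; rewrite -?wS -?wT.
Qed.

Theorem theorem3p6 (R : realType) (X : normedModType R)
  (M : set X) (q : X) (S T : X -> X)
  (phi gamma psi varphi : R -> R) (F : R -> R -> R)
  (hM : starshaped M q)
  (hS : set_fun M M S) (hT : set_fun M M T)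
  (hq : Fix M S q)
  (hphi : integrand_class phi)
  (hgamma : comparison_function gamma)
  (hi : exists n0 : nat, JH_suboperator_pair M q S T n0)
  (hpsi : altering_distance psi)
  (hvarphi : ultra_altering_distance varphi)
  (hF : C_class F)
  (hmono : strictly_monotone_triple psi varphi F)
  (hii : forall x y, M x -> M y -> forall k : R, 0 < k < 1 ->
    psi (integral0 phi `|T x - T y|) <=
    F (psi (integral0 phi (k^-1 * gamma `|S x - S y|)))
      (varphi (integral0 phi (k^-1 * gamma `|S x - S y|))))
  (hcompact : weakly_compact (wcl (T @` M)))
  (hcont : weakly_continuous_on M S)
  (hOpial : Opial X) :
  Fix M S `&` Fix M T !=set0.
Proof.
have [n /(_ 1)] := hi.
rewrite ler01 lexx subrr => /(_ isT).
rewrite (_ : (fun x => _) = T); last first.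
  by apply/funext => x; rewrite scale0r add0r scale1r.
apply: JH_operator_pair_common_fixed_point.
move=> _ _ [x Mx [-> STx]] [y My [-> STy]].
apply/eqP; rewrite -subr_eq0 -normr_eq0; apply/negPn/negP => d_neq0.
have d0 : 0 < `|S x - S y| by rewrite lt_neqAle eq_sym d_neq0 normr_ge0.
have [/(_ _ d0)/andP[g0 gd] _ _ _] := hgamma.
have := hii _ _ Mx My (gamma `|S x - S y| / `|S x - S y|).
rewrite divr_gt0// ltr_pdivrMr// mul1r gd => /(_ isT).
(* Now [k^-1 * gamma d = d], and coincidence turns [T x - T y] into [S x - S y]: with [I] the
   integral over [0, d], (ii) reads [psi I <= F (psi I) (varphi I)]. *)
rewrite invf_div divfK ?gt_eqF// -STx -STy leNgt => /negP; apply.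
(* [d > 0] gives [I > 0], so both arguments of [F] are positive. *)
have [_ _ _ /(_ _ d0) I0] := hphi.
have [_ _ _ /(_ _ I0) v0] := hvarphi.
by apply: C_class_lt => //; exact: altering_distance_gt0.
Qed.
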